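(* Let $d$ be a positive integer, and let $\varphi:\mathbb T^d\to\mathbb T^d$ be an affine self-mapping of the torus, $\varphi(x)=Ax+b$, where $A$ is an integer $d\times d$ matrix with $\det A=\pm1$ and $b\in\mathbb T^d$. Then the cascade $(\mathbb T^d, G_\varphi)$ generated by $\varphi$ is tame if and only if there exists a positive integer $m$ such that $A^m=I$, where $I$ is the identity matrix.
   Context: $\mathbb T^d=\mathbb R^d/(2\pi\mathbb Z)^d$ is the $d$-dimensional torus with its usual (compact, metrizable) topology. An affine self-mapping of $\mathbb T^d$ is a map of the form $\varphi(x)=Ax+b$ with $A$ an integer $d\times d$ matrix (called the matrix of $\varphi$) and $b\in\mathbb T^d$. It is a self-homeomorphism exactly when $A$ is nonsingular with integer inverse, i.e., when $\det A=\pm1$. For a self-homeomorphism $\varphi:X\to X$, the cascade generated by $\varphi$ is the system $(X,G_\varphi)$, where $G_\varphi=\{\varphi^n : n\in\mathbb Z\}$ is the group of iterations of $\varphi$ (for $n<0$, $\varphi^n$ are the iterations of the inverse mapping $\varphi^{-1}$). Tameness (Köhler). A sequence $f_n$, $n=1,2,\ldots$, of real-valued functions on a set $X$ is independent if there exist $a,b\in\mathbb R$, $a<b$, such that $\bigcap_{n\in P}\{x: f_n(x)<a\}\cap\bigcap_{n\in Q}\{x: f_n(x)>b\}\neq\varnothing$ for all finite disjoint sets $P,Q$ of indices. Let $X$ be a compact Hausdorff space and $G$ a group or semigroup of continuous mappings of $X$ into itself. The system $(X,G)$ is tame if for every real-valued continuous function $f$ on $X$ the family $\{f_g: g\in G\}$,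 where $f_g(x)=f(gx)$, does not contain an independent sequence. When $X$ is a compact metric space (as here), the paper uses the following equivalent definition: $(X,G)$ is tame if each sequence $g_n\in G$, $n=1,2,\ldots$, has a subsequence $g_{n_k}$, $k=1,2,\ldots$, that converges pointwise, i.e., such that for every $x\in X$ the sequence $g_{n_1}x,g_{n_2}x,\ldots$ converges in $X$. *)

(* Defs.v *)
From HB Require Import structures.
From mathcomp Require Import all_boot all_order all_algebra.
From mathcomp Require Import all_classical all_reals all_analysis.

Set Implicit Arguments.
Unset Strict Implicit.
Unset Printing Implicit Defensive.

Import Order.TTheory GRing.Theory Num.Theory.
Import numFieldNormedType.Exports.

Local Open Scope classical_set_scope.
Local Open Scope ring_scope.
Local Open Scope quotient_scope.

Section Torus.
Variables (R : realType) (d : nat).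

Definition period_lattice : {pred 'cV[R]_d} := fun x =>
  [forall i, x i ord0 / (2 * pi) \is a Num.int].

Lemma period_lattice_zmod_closed : zmod_closed period_lattice.
Proof.
split=> [|x y /forallP xP /forallP yP]; apply/forallP => i.
  by rewrite mxE mul0r rpred0.
by rewrite !mxE mulrBl rpredB.
Qed.

HB.instance Definition _ :=
  GRing.isZmodClosed.Build 'cV[R]_d period_lattice period_lattice_zmod_closed.

(* R^d / (2 pi Z)^d, as a topological space (quotient topology) and as an
   abelian group (quotient group). *)
Definition torus : Type := quotient_topology (Quotient.quot period_lattice).

HB.instance Definition _ := Topological.on torus.
HB.instance Definition _ := Quotient.on torus.
HB.instance Definition _ :=
  GRing.Zmodule.copy torus (Quotient.quot period_lattice).

Lemma torus_eqP (x y : 'cV[R]_d) :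
  \pi_torus x = \pi_torus y <-> period_lattice (x - y).
Proof.
have E : period_lattice (x - y) = _ := @Quotient.idealrBE _ period_lattice x y.
by rewrite E; split=> [xy|/eqP//]; exact/eqP.
Qed.

Lemma torus_piD (x y : 'cV[R]_d) :
  \pi_torus (x + y) = \pi_torus x + \pi_torus y.
Proof. exact: (@Quotient.pi_add _ period_lattice). Qed.

(* The map x |-> A x + b; the choice of a representative of x is immaterial
   by torus_affine_pi. *)
Definition torus_affine (A : 'M[int]_d) (b : torus) (x : torus) : torus :=
  \pi_torus (map_mx intr A *m repr x) + b.

Lemma torus_affine_pi A b (x : 'cV[R]_d) :
  torus_affine A b (\pi_torus x) = \pi_torus (map_mx intr A *m x) + b.
Proof.
congr (_ + _); apply/torus_eqP; rewrite -mulmxBr.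
have /torus_eqP/forallP H : \pi_torus (repr (\pi_torus x)) = \pi_torus x.
  by rewrite reprK.
apply/forallP => i; rewrite mxE mulr_suml rpred_sum// => j _.
by rewrite !mxE -mulrA rpredM ?intr_int//; have := H j; rewrite !mxE.
Qed.

End Torus.

(* f^n for n in Z; the partial inverse 'pinv_ is the two-sided inverse of f as
   soon as f is bijective. *)
Definition iterz (X : Type) (f : X -> X) (n : int) : X -> X :=
  match n with
  | Posz k => iter k f
  | Negz k => iter k.+1 ('pinv_id setT f)
  end.

Lemma iterz_inv (X : Type) (f : X -> X) :
  bijective f -> cancel f (iterz f (-1)) /\ cancel (iterz f (-1)) f.
Proof.
move=> [g fK gK].
have K : {in setT, cancel f ('pinv_id setT f)}.
  by apply: pinvKV => x y _ _; exact: (can_inj fK).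
have {}K x : 'pinv_id setT f (f x) = x by apply: K; rewrite inE.
split=> x; first exact: K.
have Kx : 'pinv_id setT f x = g x by rewrite -{1}(gK x) K.
by rewrite -[X in f X]/('pinv_id setT f x) Kx gK.
Qed.

Definition iteration_group (X : Type) (f : X -> X) : set (X -> X) :=
  range (iterz f).

Lemma torus_affine_bij (R : realType) (d : nat) (A : 'M[int]_d) (b : torus R d) :
  \det A = 1 \/ \det A = -1 -> bijective (torus_affine A b).
Proof.
move=> detA.
have uA : A \in unitmx.
  by rewrite unitmxE; case: detA => ->; rewrite ?unitrN unitr1.
have inj (B C : 'M[int]_d) : B *m C = 1%:M ->
    cancel (fun x : torus R d => torus_affine C 0 x) (torus_affine B 0).
  move=> BC x; rewrite -[x]reprK torus_affine_pi addr0 torus_affine_pi addr0.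
  by rewrite mulmxA -map_mxM BC map_mx1 mul1mx.
have E x : torus_affine A b x = torus_affine A 0 x + b.
  by rewrite /torus_affine addr0.
exists (fun y => torus_affine (invmx A) 0 (y - b)) => x; rewrite E.
  by rewrite addrK inj// mulVmx.
by rewrite inj ?mulmxV// subrK.
Qed.

(* Tameness of (X, G) for X compact metrizable: every sequence in G has a
   pointwise convergent subsequence. *)
Definition tame (X : topologicalType) (G : set (X -> X)) : Prop :=
  forall g : nat -> X -> X, (forall n, G (g n)) ->
  exists k : nat -> nat, {homo k : i j / (i < j)%N} /\
    forall x : X, exists l : X, g (k n) x @[n --> \oo] --> l.

(* Main.v *)
Require Import Defs.
From mathcomp Require Import all_boot all_order all_algebra.
From mathcomp Require Import all_classical all_reals all_analysis.
From mathcomp Require Import measurable_realfun.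

(* If A^m = I, every element of the group has the form x |-> A^r x + c with
   r < m: pigeonhole on r and compactness of the torus for c give a pointwise
   convergent subsequence.  Conversely, phi^n x = A^n x + c_n, so along a
   pointwise convergent subsequence phi^(k_n) the cosine of every coordinate
   of phi^(k_(n+1)) x - phi^(k_n) x tends to 1.  For x = t e_j the i-th
   coordinate is m_n t + b_n, where the integer m_n is the (i, j) entry of
   A^(k_(n+1)) - A^(k_n); by dominated convergence the integral over a period
   of cos (m_n t + b_n), which is 0 unless m_n = 0, tends to 2 pi.  Hence
   A^(k_(n+1)) = A^(k_n) for large n, and A is invertible. *)

Import Order.TTheory GRing.Theory Num.Theory.
Import numFieldNormedType.Exports.

Local Open Scope ring_scope.
Local Open Scope classical_set_scope.
Local Open Scope quotient_scope.

(** * Cosine integrals and integer frequencies *)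

Lemma periodicz (U V : zmodType) (f : U -> V) (T : U) (z : int) (x : U) :
  periodic f T -> f (x + T *~ z) = f x.
Proof.
move=> fT; case: z => n; first exact: periodicn.
by rewrite NegzE mulrNz -[in RHS](subrK (T *+ n.+1) x) periodicn.
Qed.

Lemma continuous_cos_affine (R : realType) (a b : R) :
  continuous (fun t => cos (a * t + b)).
Proof.
move=> t; apply: continuous_comp; last exact: continuous_cos.
by apply: cvgD; [exact: mulrl_continuous|exact: cvg_cst].
Qed.

Lemma integral_cos_period (R : realType) (m : int) (b : R) : m != 0 ->
  (\int[lebesgue_measure]_(t in `[0%R, (pi *+ 2)%R])
     (cos (m%:~R * t + b))%:E = 0)%E.
Proof.
move=> m0; have mR0 : m%:~R != 0 :> R by rewrite intr_eq0.
(* A primitive of the integrand; since [m] is a nonzero integer, it takes the same value at both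
   ends of the period. *)
pose F (t : R) := (m%:~R)^-1 * sin (m%:~R * t + b).
have dF (t : R) : is_derive t 1 F (cos (m%:~R * t + b)).
  apply: is_derive_eq.
  by rewrite addr0 /GRing.scale/= mulr1 mulrCA mulVf ?mulr1.
have cF : continuous F.
  move=> t; apply: differentiable_continuous.
  by apply/derivable1_diffP; case: (dF t).
rewrite (@continuous_FTC2 _ _ F).
- rewrite /F mulr0 add0r mulrzl [_ + b]addrC.
  by rewrite (periodicz _ _ _ _ _ _ (@sinD2pi R)) subee.
- by rewrite pmulrn_rgt0// pi_gt0.
- by apply: continuous_subspaceT; exact: continuous_cos_affine.
- split; first by move=> t _; case: (dF t).
  - exact/cvg_at_right_filter/cF.
  - exact/cvg_at_left_filter/cF.
- by move=> t _; rewrite derive1E; case: (dF t).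
Qed.

Lemma cos_cvg1_eventually0 (R : realType) (m : nat -> int) (b : nat -> R) :
  (forall t : R, cos ((m n)%:~R * t + b n) @[n --> \oo] --> (1 : R)) ->
  \forall n \near \oo, m n = 0.
Proof.
move=> cos1; pose D : set R := `[0, pi *+ 2].
have mD : measurable D by exact: measurable_itv.
have int1 : (\int[lebesgue_measure]_(t in D) cst 1 t)%E = (pi *+ 2)%:E.
  rewrite integral_cst// mul1e; apply: etrans (lebesgue_measure_itv _) _.
  by rewrite /= lte_fin pmulrn_rgt0 ?pi_gt0// sube0.
have mcos n : measurable_fun D (EFin \o (fun t => cos ((m n)%:~R * t + b n))).
  apply/measurable_EFinP; apply: measurable_funTS.
  by apply: continuous_measurable_fun; exact: continuous_cos_affine.
have [|||_ _] := @dominated_convergence _ _ _ lebesgue_measure _ mD _ _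
  (cst 1%E) mcos (measurable_cst 1%E).
- by apply: aeW => t _; apply: cvg_EFin; [exact: nearW|exact: cos1].
- apply/integrableP; split; first exact: measurable_cst.
  by under eq_integral do rewrite abse1; rewrite int1 ltry.
- by apply: aeW => t n _; rewrite lee_fin ler_norml cos_geN1 cos_le1.
(* The limit is positive, so the integrals are eventually positive, whereas a nonzero frequency
   makes the integral vanish. *)
rewrite int1 => /fine_cvgP[_ /cvgr_gt/(_ 0)].
rewrite pmulrn_rgt0 ?pi_gt0// => /(_ isT); apply: filterS => n.
by apply: contraTeq => mn0; rewrite /= integral_cos_period ?ltxx.
Qed.

(** * Subsequences and sequential compactness of the torus *)

Lemma increasing_seq_homo (f : nat -> nat) :
  increasing_seq f -> {homo f : i j / (i < j)%N}.
Proof. by move=> If i j ij; have := leW_mono If i j; rewrite ltEnat /= ij. Qed.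

Lemma subseq_comp (f g : nat -> nat) :
  increasing_seq f -> increasing_seq g -> increasing_seq (f \o g).
Proof. by move=> If Ig n m; rewrite /= If; exact: Ig. Qed.

Lemma cvg_subseq (T : topologicalType) (u : nat -> T) (l : T) (f : nat -> nat) :
  increasing_seq f -> u @ \oo --> l -> u \o f @ \oo --> l.
Proof.
move=> If; apply: cvg_comp => A [N _ NA]; exists N => // n /= Nn.
(* A strictly increasing [f] satisfies [n <= f n]. *)
apply: NA => /=; apply: leq_trans Nn _; elim: n => // n IHn.
apply: leq_ltn_trans IHn _; exact: increasing_seq_homo.
Qed.

Lemma cv_cvg (R : realType) (d : nat) (v : nat -> 'cV[R]_d) :
  (forall i, cvgn (fun n => v n i ord0)) -> cvgn v.
Proof.
move=> cv; apply/cvg_ex; exists (\col_i limn (fun n => v n i ord0)).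
apply: (cvg_mx_entourageP _ _ _ (v @ \oo) _ _).2 => E entE.
apply: filter_forall => i.
have vE : \forall n \near \oo, E (limn (fun n => v n i ord0), v n i ord0).
  exact: (cvg_app_entourageP _ _ _).1 (cv i) E entE.
by apply: filterS vE => n En /= j; rewrite (ord1 j) mxE; apply: mem_set.
Qed.

Lemma bolzano_weierstrass_cV (R : realType) (d : nat) (v : nat -> 'cV[R]_d)
    (M : R) :
  (forall n i, `|v n i ord0| <= M) ->
  exists2 f : nat -> nat, increasing_seq f & cvgn (v \o f).
Proof.
move=> vM.
(* Coordinates are treated one at a time: each step refines the subsequence, which preserves the
   limits already obtained. *)
suff [f If cf] : exists2 f : nat -> nat, increasing_seq f &
    forall i, i \in enum 'I_d -> cvgn (fun n => v (f n) i ord0).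
  by exists f => //; apply: cv_cvg => i; apply: cf; rewrite mem_enum.
elim: (enum 'I_d) => [|i s [f If cf]]; first by exists id.
have [|g Ig cg] := @bolzano_weierstrass R (fun n => v (f n) i ord0).
  exists M; split; first exact: num_real.
  by move=> N MN n _ /=; rewrite (le_trans (vM _ _))// ltW.
exists (f \o g); first exact: subseq_comp.
move=> j; rewrite inE => /predU1P[->//|/cf /cvg_ex[l cl]].
by apply/cvg_ex; exists l; apply: (cvg_subseq _ _ _ _ Ig cl).
Qed.

Lemma torus_seq_compact (R : realType) (d : nat) (u : nat -> torus R d) :
  exists2 f : nat -> nat, increasing_seq f &
    exists l : torus R d, u (f n) @[n --> \oo] --> l.
Proof.
have pi2 : 0 < 2 * pi :> R by rewrite mulr_gt0// pi_gt0.
(* The representative of [u n] with all coordinates in [0, 2 pi), hence a bounded sequence of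
   lifts. *)
pose v n : 'cV[R]_d := \col_i (repr (u n) i ord0 -
  (Num.floor (repr (u n) i ord0 / (2 * pi)))%:~R * (2 * pi)).
have uv n : u n = \pi_(torus R d) (v n).
  rewrite -[LHS]reprK; apply/torus_eqP/forallP => i.
  by rewrite !mxE opprB addrCA subrr addr0 mulfK ?gt_eqF.
have [|f If /cvg_ex[l cl]] := bolzano_weierstrass_cV _ _ v (2 * pi).
  move=> n i; rewrite mxE; set x := repr (u n) i ord0.
  have /andP[fx xf] := floor_itv (x / (2 * pi)).
  rewrite ger0_norm ?subr_ge0 -?ler_pdivlMr// lerBlDr -[X in X + _]mul1r.
  by rewrite -mulrDl -ler_pdivrMr// ltW// addrC -intrD1.
exists f => //; exists (\pi_(torus R d) l).
under eq_fun do rewrite uv.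
exact: (cvg_comp _ _ cl (@pi_continuous _ _ l)).
Qed.

(** * Affine maps and periodic functions on the torus *)

Lemma torus_affine_comp (R : realType) (d : nat) (A B : 'M[int]_d)
    (a b x : torus R d) :
  torus_affine B b (torus_affine A a x) =
  torus_affine (B *m A) (torus_affine B b a) x.
Proof.
rewrite -[x]reprK -[a]reprK torus_affine_pi -torus_piD !torus_affine_pi.
by rewrite mulmxDr torus_piD mulmxA map_mxM addrA.
Qed.

Lemma torus_affine1 (R : realType) (d : nat) (a x : torus R d) :
  torus_affine 1%:M a x = x + a.
Proof. by rewrite -[x]reprK torus_affine_pi map_mx1 mul1mx. Qed.

Lemma torus_addr_continuous (R : realType) (d : nat) (x : torus R d) :
  continuous (+%R x).
Proof.
apply/quotient_continuous => y.
have -> : +%R x \o \pi_(torus R d) = \pi_(torus R d) \o +%R (repr x).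
  by apply/funext => z; rewrite /= torus_piD reprK.
apply: continuous_comp; last exact: pi_continuous.
exact: (cvgD (cvg_cst _) cvg_id).
Qed.

(** Two lifts of a point differ by integer multiples of 2 pi in each coordinate; this lets [cos] and
    [sin] be evaluated on any convenient lift. *)
Lemma torus_eq_periodic (R : realType) (d : nat) (i : 'I_d) (f : R -> R)
    (x y : 'cV[R]_d) :
  periodic f (pi *+ 2) -> \pi_(torus R d) x = \pi_(torus R d) y ->
  f (x i ord0) = f (y i ord0).
Proof.
move=> pf /torus_eqP/forallP/(_ i)/intrP[m].
have pi2 : 2 * pi != 0 :> R by rewrite gt_eqF// mulr_gt0// pi_gt0.
rewrite !mxE => /(canRL (mulfVK pi2)) E.
by rewrite -(subrK (y i ord0) (x i ord0)) E mulrzl mulr_natl addrC periodicz.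
Qed.

(** The section [repr] need not be continuous, but by periodicity the function is constant on fibres
    of the projection and so descends to the quotient. *)
Lemma torus_periodic_continuous (R : realType) (d : nat) (i : 'I_d)
    (f : R -> R) :
  continuous f -> periodic f (pi *+ 2) ->
  continuous (fun x : torus R d => f (repr x i ord0)).
Proof.
move=> cf pf.
have cg : continuous (fun x : 'cV[R]_d => f (x i ord0)).
  by move=> x; apply: continuous_comp; [exact: coord_continuous|exact: cf].
apply: (repr_comp_continuous cg) => x y /eqP xy.
by apply/eqP; exact: torus_eq_periodic.
Qed.

Lemma iter_torus_affine (R : realType) (d : nat) (A : 'M[int]_d)
    (b : torus R d) (n : nat) :
  iter n (torus_affine A b) =1
  torus_affine (A ^+ n) (iter n (torus_affine A b) 0).
Proof.
move=> x; elim: n => [|n IHn]; first by rewrite torus_affine1 addr0.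
by rewrite iterS IHn torus_affine_comp exprS.
Qed.

(** * Finite order implies tameness *)

Lemma torus_affine_finite_tame (R : realType) (d m : nat)
    (A : 'I_m -> 'M[int]_d) (G : set (torus R d -> torus R d)) :
  (forall g, G g -> exists r c, g =1 torus_affine (A r) c) -> tame G.
Proof.
move=> GA g Gg.
have /choice[r /choice[c gE]] n := GA _ (Gg n).
(* Some matrix index [r0] occurs on an infinite set [S], which [f] enumerates increasingly; then [h]
   makes the translation parts converge. *)
have [r0 [S Soo Sr]] := @finite_range_cst_subsequence _ r finite_finset.
have [|f [If _ Sf]] := @infinite_increasing_seq_wf _ nat S _ Soo 0%N.
  by move=> n; apply: sub_finite_set (finite_II n.+1) => k.
have [h Ih [l cl]] := torus_seq_compact R d (c \o f).
exists (f \o h); split; first exact/increasing_seq_homo/subseq_comp.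
move=> x; exists (torus_affine (A r0) 0 x + l).
under eq_fun do rewrite /= gE (Sr _).1 //.
have -> : (fun n => torus_affine (A r0) (c (f (h n))) x) =
    (+%R (torus_affine (A r0) 0 x)) \o (fun n => c (f (h n))).
  by apply/funext => n; rewrite /= /torus_affine addr0.
by apply: cvg_comp cl _; exact: torus_addr_continuous.
Qed.

Lemma iteration_group_torus_affine (R : realType) (d m : nat) (A : 'M[int]_d)
    (b : torus R d) :
  bijective (torus_affine A b) -> (0 < m)%N -> A ^+ m = 1%:M ->
  forall g, iteration_group (torus_affine A b) g ->
  exists (r : 'I_m) c, g =1 torus_affine (A ^+ r) c.
Proof.
move=> bA m0 Am.
have modm n : exists r : 'I_m, A ^+ n = A ^+ r.
  exists (Ordinal (ltn_pmod n m0)); rewrite /= [in LHS](divn_eq n m).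
  by rewrite exprD mulnC exprM Am expr1n mul1r.
set phi := torus_affine A b.
(* The inverse of [phi] written as an affine map, using that A^(m-1) is the inverse of A; negative
   iterates then also involve only nonnegative powers of A. *)
pose psi := torus_affine (A ^+ m.-1) (- torus_affine (A ^+ m.-1) 0 b).
have AAm : A ^+ m.-1 * A = 1 by rewrite -exprSr prednK.
have psiK : cancel phi psi.
  move=> x; rewrite /psi /phi torus_affine_comp [_ *m _]AAm torus_affine1.
  by rewrite /torus_affine addr0 subrr addr0.
have psiI : 'pinv_id setT phi =1 psi.
  by have [_ K] := iterz_inv bA => x; rewrite -[in RHS](K x) psiK.
move=> g [[n|n] _ <-]; rewrite /iterz.
  have [r Ar] := modm n; exists r, (iter n phi 0) => x.
  by rewrite iter_torus_affine Ar.
have [r Ar] := modm (m.-1 * n.+1)%N.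
exists r, (iter n.+1 psi 0) => x.
by rewrite (eq_iter psiI) iter_torus_affine -exprM Ar.
Qed.

(** * Tameness implies finite order *)

Lemma tame_finite_order (R : realType) (d : nat) (A : 'M[int]_d)
    (b : torus R d) :
  A \in unitmx -> tame (iteration_group (torus_affine A b)) ->
  exists m : nat, (0 < m)%N /\ A ^+ m = 1%:M.
Proof.
move=> uA /(_ (fun n => iter n (torus_affine A b)))[|k [Ik cvk]].
  by move=> n; exists (Posz n).
pose c n : 'cV[R]_d := repr (iter (k n) (torus_affine A b) 0).
pose e j t := \pi_(torus R d) (t *: delta_mx j ord0).
(* A periodic [f] does not see the choice of lift, so [repr] gives way to an explicit lift, affine
   in [t] with integer slope. *)
have perE (f : R -> R) i j t n : periodic f (pi *+ 2) ->
    f (repr (iter (k n) (torus_affine A b) (e j t)) i ord0)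
    = f (((A ^+ k n) i j)%:~R * t + c n i ord0).
  move=> pf; rewrite iter_torus_affine torus_affine_pi -[iter _ _ 0]reprK.
  rewrite -torus_piD (torus_eq_periodic _ _ _ _ _ _ pf (reprK _)).
  by rewrite -scalemxAr -colE !mxE mulrC.
have cos1 i j (t : R) : cos (((A ^+ k n.+1) i j - (A ^+ k n) i j)%:~R * t +
    (c n.+1 i ord0 - c n i ord0)) @[n --> \oo] --> (1 : R).
  have [l cl] := cvk (e j t).
  pose a n := ((A ^+ k n) i j)%:~R * t + c n i ord0.
  have fcvg (f : R -> R) : continuous f -> periodic f (pi *+ 2) ->
      f (a n) @[n --> \oo] --> f (repr l i ord0).
    move=> cf pf; under eq_fun do rewrite -perE//.
    exact: (cvg_comp _ _ cl (torus_periodic_continuous R d i f cf pf l)).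
  have fcvgS (f : R -> R) : continuous f -> periodic f (pi *+ 2) ->
      f (a n.+1) @[n --> \oo] --> f (repr l i ord0).
    by move=> cf pf; rewrite (cvg_shiftS (f \o a)); exact: fcvg.
  have ccos := (@continuous_cos R, @cosD2pi R).
  have csin := (@continuous_sin R, @sinD2pi R).
  (* The subtraction formula turns convergence on the torus into a limit: both factors of each
     product tend to the same value at [l], and the sum of squares is 1. *)
  have cosB_a n : cos (((A ^+ k n.+1) i j - (A ^+ k n) i j)%:~R * t +
      (c n.+1 i ord0 - c n i ord0)) =
      cos (a n.+1) * cos (a n) + sin (a n.+1) * sin (a n).
    by rewrite -cosB rmorphB mulrBl addrACA opprD.
  under eq_fun do rewrite cosB_a.
  rewrite -(cos2Dsin2 (repr l i ord0)) !expr2.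
  exact: (cvgD (cvgM (fcvgS _ ccos.1 ccos.2) (fcvg _ ccos.1 ccos.2))
    (cvgM (fcvgS _ csin.1 csin.2) (fcvg _ csin.1 csin.2))).
(* There are finitely many entries, so one [n] serves them all. *)
have [n _ nE] : \forall n \near \oo, forall ij : 'I_d * 'I_d,
    (A ^+ k n.+1) ij.1 ij.2 - (A ^+ k n) ij.1 ij.2 = 0.
  by apply: filter_forall => -[i j]; exact: cos_cvg1_eventually0 (cos1 i j).
have kn := Ik _ _ (ltnSn n).
exists (k n.+1 - k n)%N; split; first by rewrite subn_gt0.
have uAn p : A ^+ p \in unitmx.
  by elim: p => [|p IHp]; rewrite ?unitmx1// exprS unitmx_mul uA.
(* Cancelling the invertible A^(k n) in A^(k (n+1)) = A^(k n) gives the identity. *)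
apply: (can_inj (mulmxK (uAn (k n)))); rewrite mul1mx.
rewrite [LHS](_ : _ = A ^+ k n.+1).
  by apply/matrixP => i j; apply/eqP; rewrite -subr_eq0 (nE n _ (i, j))//=.
by rewrite -[LHS]exprD subnK// ltnW.
Qed.

Theorem theorem2 (R : realType) (d : nat) (hd : (0 < d)%N)
    (A : 'M[int]_d) (hA : \det A = 1 \/ \det A = -1) (b : torus R d) :
  tame (iteration_group (torus_affine A b)) <->
  exists m : nat, (0 < m)%N /\ A ^+ m = 1%:M.
Proof.
split=> [|[m [m0 Am]]].
  apply: tame_finite_order; rewrite unitmxE.
  by case: hA => ->; rewrite ?unitrN unitr1.
apply: torus_affine_finite_tame.
exact: (iteration_group_torus_affine _ _ _ _ _ (torus_affine_bij b hA) m0 Am).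
Qed.
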